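(* Let $X=\{X_t;\ t\in\mathbf{R}_+\}$ be a generalized Weierstrass function with parameter function $H:\mathbf{R}_+\to(0,1)$ such that, for some open interval $I$, $$\forall t\in I;\quad H(t)<\tilde{\beta}(t),$$ where $\tilde{\beta}(t)$ is the local Hölder exponent of $H$ at $t$. Then, almost surely, for any $t_0\in I$, the $2$-microlocal frontier of $X$ at $t_0$ in the region $$D=\{(s',\sigma):\ -1<s'<0,\ 0<\sigma<1+s'\}$$ is equal to the line $\sigma=H(t_0)+s'$ (that is, the part of the graph of $\boldsymbol{\sigma}_{t_0}$ in $D$ coincides with the part of this line in $D$).
   Context: Let $\lambda\ge2$ and let $(Z_j)_{j}$ be i.i.d. $\mathcal{N}(0,1)$ random variables. The generalized Weierstrass function (GW) is the Gaussian process $$X_t=\sum_{j=1}^{\infty}Z_j\,\lambda^{-jH(t)}\sin(\lambda^j t),\qquad t\in\mathbf{R}_+=[0,\infty),$$ where $t\mapsto H(t)$ takes values in $(0,1)$. (The paper states that $X$ is Hölder-continuous but not differentiable.) $B(t_0,\rho)$ is the ball of centre $t_0$ and radius $\rho$ in $\mathbf{R}_+$; suprema are over $t\ne u$. The $2$-microlocal frontier of $X$ at $t_0$ is, for $s'\in(-\infty,0)$, $$\boldsymbol{\sigma}_{t_0}(s')=\sup\Big\{\sigma:\limsup_{\rho\to0}\sup_{t,u\in B(t_0,\rho)}\frac{|X_t-X_u|}{|t-u|^{\sigma}\rho^{-s'}}<\infty\Big\},$$ and the local Hölder exponent of $H$ is $$\tilde\beta(t_0)=\sup\Big\{\beta:\limsup_{\rho\to0}\sup_{t,u\in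 B(t_0,\rho)}\frac{|H(t)-H(u)|}{|t-u|^{\beta}}<\infty\Big\}.$$ *)

(* Defs.v *)
From HB Require Import structures.
From mathcomp Require Import all_boot all_order all_algebra.
From mathcomp Require Import finmap.
From mathcomp Require Import all_classical all_reals all_analysis.

Set Implicit Arguments.
Unset Strict Implicit.
Unset Printing Implicit Defensive.

Import Order.TTheory GRing.Theory Num.Theory.
Import numFieldNormedType.Exports.

Local Open Scope classical_set_scope.
Local Open Scope ring_scope.

Definition mutually_independent d (T : measurableType d) (R : realType)
    (P : probability T R) (I : choiceType) (D : set I)
    (Z : I -> {RV P >-> R}) : Prop :=
  forall (J : {fset I}) (A : I -> set R),
    [set` J] `<=` D -> (forall j, measurable (A j)) ->
    P (\bigcap_(j in [set` J]) (Z j @^-1` A j)) =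
      (\prod_(j <- J) P (Z j @^-1` A j))%E.

Definition standard_normal d (T : measurableType d) (R : realType)
    (P : probability T R) (Y : {RV P >-> R}) : Prop :=
  forall A : set R, measurable A -> distribution P Y A = normal_prob 0 1 A.

(* The variables [Z j] with [1 <= j] are constrained; [Z 0] is never used. *)
Definition iid_standard_normal d (T : measurableType d) (R : realType)
    (P : probability T R) (Z : nat -> {RV P >-> R}) : Prop :=
  mutually_independent [set j | (1 <= j)%N] Z /\
  forall j, (1 <= j)%N -> standard_normal (Z j).

(* Pathwise sum of the series; when all [H t] are positive it converges, almost
   surely, for all [t] simultaneously, and [limn] is a junk value elsewhere. *)
Definition weierstrass d (T : measurableType d) (R : realType)
    (P : probability T R) (lambda : R) (H : R -> R) (Z : nat -> {RV P >-> R})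
    (w : T) (t : R) : R :=
  limn (fun n : nat => \sum_(1 <= j < n)
    Z j w * lambda `^ (- (j%:R * H t)) * sin (lambda ^+ j * t)).

(* Functions on the half-line are represented by functions on [R] of which only
   the values at nonnegative arguments matter. *)
Definition nneg_ball (R : realType) (t0 rho : R) : set R :=
  [set t | 0 <= t /\ `|t - t0| < rho].

Definition distinct_pairs (R : realType) (B : set R) : set (R * R) :=
  [set p | [/\ B p.1, B p.2 & p.1 <> p.2]].

Definition microlocal_frontier (R : realType) (f : R -> R) (t0 s' : R) :
    \bar R :=
  ereal_sup [set sigma%:E | sigma in [set sigma : R |
    (limf_esup (fun rho : R => ereal_sup
       [set (`|f p.1 - f p.2| / (`|p.1 - p.2| `^ sigma * rho `^ (- s')))%:E
         | p in distinct_pairs (nneg_ball t0 rho)])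
      (0 : R)^'+ < +oo)%E]].

Definition local_holder_exponent (R : realType) (f : R -> R) (t0 : R) :
    \bar R :=
  ereal_sup [set beta%:E | beta in [set beta : R |
    (limf_esup (fun rho : R => ereal_sup
       [set (`|f p.1 - f p.2| / `|p.1 - p.2| `^ beta)%:E
         | p in distinct_pairs (nneg_ball t0 rho)])
      (0 : R)^'+ < +oo)%E]].

Definition frontier_region (R : realType) : set (R * R) :=
  [set p | -1 < p.1 < 0 /\ 0 < p.2 < 1 + p.1].

(* Main.v *)
(* Almost surely [Z j] grows at most linearly in [j] and does not tend to 0;
   everything else holds path by path, simultaneously at all points, for
   coefficients [z] with these two properties.
   Freezing the exponent at [h = H t0] perturbs the series near [t0] by at most a
   multiple of [|H t - H t0|], hence by [O(|t - t0|^beta)] with [beta > h]. So near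
   [t0] the path is Hoelder of every order [a < h], which bounds the frontier from
   below by [h + s'].
   Conversely, suppose the frozen series is [O(|t - t0|^h')] at [t0] with [h' > h].
   Averaging its increments of step [pi / lambda^j] against [cos (lambda^j t)] along
   an arithmetic progression of step [lambda^(-m-j)] starting at [t0] isolates the
   [j]-th frequency: the nearby ones cancel by the Dirichlet kernel bound, the low
   ones are damped by the increment, the high ones by [lambda^(-k h)]. This bounds
   [|z j|] by [O(lambda^(-(h'-h) j))] plus a small multiple of a geometrically
   weighted average of the other [|z k|], and iterating makes [z] decay
   geometrically, a contradiction. Hence the pointwise exponent is at most [h] at
   every point, and pairs [(t, t0)] with [rho = 2 |t - t0|] bound the frontier from
   above by [h + s']. *)

Require Import Defs.
From HB Require Import structures.
From mathcomp Require Import all_boot all_order all_algebra.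
From mathcomp Require Import finmap.
From mathcomp Require Import all_classical all_reals all_analysis.
From mathcomp Require Import measurable_realfun.
From mathcomp Require Import ring lra.

Import Order.TTheory GRing.Theory Num.Theory.
Import numFieldNormedType.Exports.

Local Open Scope classical_set_scope.
Local Open Scope ring_scope.

(** * Powers and geometric sums *)

Section powers.
Variables (R : realType) (b : R).
Hypothesis b_gt1 : 1 < b.

Let b_gt0 : 0 < b. Proof. exact: lt_trans b_gt1. Qed.

Lemma powRDgt0 (x y : R) : b `^ (x + y) = b `^ x * b `^ y.
Proof. by rewrite powRD//; apply/implyP => _; rewrite gt_eqF. Qed.

Lemma powR_expR (x : R) : b `^ x = expR (x * ln b).
Proof. by rewrite /powR gt_eqF. Qed.

(** With [a = eta * ln b / 2] and [m = min 1 a], one has [m * (1 + j) <= 1 + a * j <= expR (a * j)];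
    squaring gives [C = m ^- 2]. *)
Lemma sqr_nat_le_powR (eta : R) : 0 < eta ->
  exists2 C : R, 0 < C & forall j : nat, (1 + j%:R) ^+ 2 <= C * b `^ (eta * j%:R).
Proof.
move=> eta0; pose a := eta * ln b / 2.
have a0 : 0 < a by rewrite divr_gt0// mulr_gt0// ln_gt0.
pose m := Num.min 1 a.
have m0 : 0 < m by rewrite lt_min ltr01.
exists (m ^- 2) => [|j]; first by rewrite invr_gt0 exprn_gt0.
rewrite powR_expR ler_pdivlMl ?exprn_gt0// -exprMn.
have -> : eta * j%:R * ln b = (a * j%:R) + (a * j%:R) by rewrite /a; field.
rewrite expRD -expr2 lerXn2r// ?nnegrE ?expR_ge0//.
  by rewrite mulr_ge0 ?ltW// addr_ge0.
apply: le_trans (expR_ge1Dx _).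
rewrite mulrDr mulr1 lerD// ?ge_min ?lexx//.
by rewrite ler_wpM2r// ge_min lexx orbT.
Qed.

(** For [x <= y], factoring out [b^(-jx)] leaves [1 - expR (- u) <= u]. The factor is [1 + j] rather
    than [j] to match the weight of [weighted_sum_le]. *)
Lemma powRN_lipschitz (j : nat) (m x y : R) : m <= x -> m <= y ->
  `|b `^ (- (j%:R * x)) - b `^ (- (j%:R * y))| <=
  b `^ (- (j%:R * m)) * (ln b * (1 + j%:R) * `|x - y|).
Proof.
wlog xy : x y / x <= y => [hw mx my|mx my].
  have [xy|/ltW yx] := leP x y; first exact: hw.
  by rewrite distrC (distrC x); exact: hw.
have lnb : 0 <= ln b by rewrite ln_ge0// ltW.
have mono u v : u <= v -> b `^ (- (j%:R * v)) <= b `^ (- (j%:R * u)).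
  by move=> uv; apply: ler_powR; [exact: ltW|rewrite lerN2 ler_wpM2l].
rewrite ger0_norm ?subr_ge0 ?mono//.
apply: (@le_trans _ _ (b `^ (- (j%:R * x)) * (ln b * j%:R * `|x - y|))); last first.
  apply: ler_pM; rewrite ?powR_ge0 ?mulr_ge0//.
    exact: mono.
  by rewrite ler_wpM2r// ler_wpM2l// lerDr.
have -> : b `^ (- (j%:R * y)) =
    b `^ (- (j%:R * x)) * expR (- (ln b * j%:R * (y - x))).
  rewrite !powR_expR -expRD; congr expR; ring.
rewrite -{1}[b `^ _]mulr1 -mulrBr ler_wpM2l ?powR_ge0//.
rewrite lerBlDr -lerBlDl distrC (ger0_norm (x := y - x)) ?subr_ge0//.
exact: expR_ge1Dx.
Qed.

Lemma geometric_sum_le (q : R) n : 0 <= q < 1 -> \sum_(i < n) q ^+ i <= (1 - q)^-1.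
Proof.
move=> /andP[q0 q1]; rewrite -[leRHS]mul1r ler_pdivlMr ?subr_gt0//.
have -> : (\sum_(i < n) q ^+ i) * (1 - q) = 1 - q ^+ n.
  elim: n => [|n IH]; first by rewrite big_ord0 mul0r expr0 subrr.
  by rewrite big_ord_recr/= mulrDl IH exprSr; ring.
by rewrite lerBlDr lerDl exprn_ge0.
Qed.
End powers.

(** * Geometric decay from a self-improving inequality *)

Section geometric_decay.
Variables (R : realType) (b : R).
Hypothesis b_gt1 : 1 < b.

Let b_gt0 : 0 < b. Proof. exact: lt_trans b_gt1. Qed.

Lemma powRN_lt1 (c : R) : 0 < c -> b `^ (- c) < 1.
Proof. by move=> c0; rewrite powR_expR// expR_lt1 mulNr oppr_lt0 mulr_gt0// ln_gt0. Qed.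

(** The terms with [k >= j] and those with [k < j] are each dominated by one geometric series,
    whence a bound uniform in [n] and [j]. *)
Lemma sum_powR_dist_le (c : R) (n j : nat) : 0 < c ->
  \sum_(1 <= k < n) b `^ (- (c * `|k%:R - j%:R|)) <= 2 / (1 - b `^ (- c)).
Proof.
move=> c0; set q := b `^ (- c).
have q01 : 0 <= q < 1 by rewrite powR_ge0 powRN_lt1.
have [q0 q1] := andP q01.
pose f (k : nat) := b `^ (- (c * `|k%:R - j%:R|)).
have fge0 k : 0 <= f k by exact: powR_ge0.
have fD i : f (j + i)%N = q ^+ i.
  rewrite /f natrD addrAC subrr add0r ger0_norm// -mulNr powRrM powR_mulrn//.
have fB (i : 'I_j) : f (rev_ord i) <= q ^+ i.
  rewrite /f /= distrC natrB ?ltn_ord// opprB addrC subrK ger0_norm//.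
  rewrite -mulNr powRrM powR_mulrn ?powR_ge0// exprS.
  by apply: ler_piMl; [exact: exprn_ge0|exact: ltW].
(* Enlarging the range to [j + n] lets it split at [j] whatever the order of [j] and [n]. *)
apply: (@le_trans _ _ (\sum_(k < j + n) f k)).
  rewrite -(big_mkord xpredT f).
  have -> : \sum_(0 <= k < j + n) f k = \sum_(0 <= k < n) f k + \sum_(n <= k < j + n) f k.
    by rewrite -big_cat_nat//= leq_addl.
  rewrite -[leLHS]addr0 lerD ?sumr_ge0//.
  case: n => [|n]; first by rewrite !big_geq.
  by rewrite (big_ltn (m := 0))// lerDr.
rewrite big_split_ord/= mulr_natl mulr2n lerD//.
  rewrite (reindex_inj rev_ord_inj)/=.
apply: le_trans _ (geometric_sum_le _ _ j q01); apply: ler_sum => i _; exact: fB.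
apply: le_trans _ (geometric_sum_le _ _ n q01); apply: ler_sum => i _.
by rewrite fD.
Qed.

(** An exponential weight moves from [x] to [y] at the price of half the decay rate. *)
Lemma powR_dist_exchange (c x y z : R) : 2 * `|z| <= c ->
  b `^ (- (c * `|x - y|)) * b `^ (z * x) <=
  b `^ (- (c / 2 * `|x - y|)) * b `^ (z * y).
Proof.
move=> zc; rewrite -!powRDgt0//; apply: ler_powR; first exact: ltW.
have : z * (x - y) <= c / 2 * `|x - y|.
  apply: le_trans (ler_norm _) _; rewrite normrM ler_wpM2r//; lra.
lra.
Qed.

Lemma half_pow_small (x e : R) : 0 < e -> exists i : nat, x / 2 ^+ i <= e.
Proof.
move=> e0; exists (Num.bound `|x / e|).
rewrite ler_pdivrMr ?exprn_gt0// mulrC -ler_pdivrMr//.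
apply: le_trans (ler_norm _) _; apply: le_trans (ltW (archi_boundP _)) _ => //.
by rewrite -natrX ler_nat; apply/ltnW/ltn_expl.
Qed.

(* A bound [G k <= B b^(mu k)] improves to [G k <= 2 C b^(-mu k) + (B/2) b^(mu k)],
   and the second term disappears on iteration. *)
Lemma geometric_decay (G : nat -> R) (C delta c kappa : R) :
  0 < c -> 0 < kappa -> 0 <= C -> 0 <= delta ->
  delta * (2 / (1 - b `^ (- (c / 2)))) <= 2^-1 ->
  (forall eta, 0 < eta ->
     exists2 B : R, 0 <= B & forall k, (1 <= k)%N -> G k <= B * b `^ (eta * k%:R)) ->
  (forall (j : nat) (S : R), (1 <= j)%N ->
     (forall n : nat, \sum_(1 <= k < n) G k * b `^ (- (c * `|k%:R - j%:R|)) <= S) ->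
     G j <= C * b `^ (- (kappa * j%:R)) + delta * S) ->
  exists A mu : R, [/\ 0 <= A, 0 < mu &
    forall j, (1 <= j)%N -> G j <= A * b `^ (- (mu * j%:R))].
Proof.
move=> c0 kappa0 C0 delta0 deltaK subexp step.
(* [mu <= kappa] dominates the source term; [2 * mu <= c] allows [powR_dist_exchange] with both [mu]
   and [- mu]. *)
pose mu := Num.min kappa (c / 2).
have mu0 : 0 < mu by rewrite lt_min kappa0 divr_gt0.
have muk : mu <= kappa by rewrite ge_min lexx.
have muc : 2 * mu <= c.
  have : mu <= c / 2 by rewrite ge_min lexx orbT.
  lra.
have [B B0 GB] := subexp mu mu0.
set K := 2 / _ in deltaK.
(* The decaying term reproduces itself at each pass, since [delta * K <= 1/2] gives
   [C + delta * K * (2 * C) <= 2 * C]. *)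
have iter (i : nat) : forall k, (1 <= k)%N ->
    G k <= 2 * C * b `^ (- (mu * k%:R)) + B / 2 ^+ i * b `^ (mu * k%:R).
  elim: i => [k k1|i IH j j1].
    rewrite expr0 divr1; apply: le_trans (GB k k1) _.
    by rewrite lerDr mulr_ge0 ?powR_ge0// mulr_ge0.
  set D := B / 2 ^+ i in IH.
  have D0 : 0 <= D by rewrite divr_ge0// exprn_ge0.
  have := step j (2 * C * (b `^ (- (mu * j%:R)) * K) + D * (b `^ (mu * j%:R) * K)) j1.
  have -> : B / 2 ^+ i.+1 = D / 2.
    by rewrite /D exprS; field; rewrite expf_neq0.
  have CK : C * b `^ (- (kappa * j%:R)) <= C * b `^ (- (mu * j%:R)).
    rewrite ler_wpM2l//; apply: ler_powR; first exact: ltW.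
    by rewrite lerN2 ler_wpM2r.
  move=> H; apply: le_trans (H _) _; last first.
    apply: le_trans (lerD CK (lexx _)) _.
    set u := b `^ (- _); set v := b `^ _.
    have u0 : 0 <= u by exact: powR_ge0.
    have v0 : 0 <= v by exact: powR_ge0.
    have := ler_wpM2l (mulr_ge0 C0 u0) deltaK.
    have := ler_wpM2l (mulr_ge0 D0 v0) deltaK.
    lra.
  move=> n.
  apply: (@le_trans _ _ (\sum_(1 <= k < n) b `^ (- (c / 2 * `|k%:R - j%:R|)) *
      (2 * C * b `^ (- (mu * j%:R)) + D * b `^ (mu * j%:R)))).
    rewrite big_nat_cond [leRHS]big_nat_cond; apply: ler_sum => k /andP[/andP[k1 _] _].
    apply: le_trans (ler_wpM2r (powR_ge0 _ _) (IH k k1)) _.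
    have e1 := @powR_dist_exchange c k%:R j%:R (- mu).
    have e2 := @powR_dist_exchange c k%:R j%:R mu.
    rewrite normrN gtr0_norm// !mulNr in e1; rewrite gtr0_norm// in e2.
    have := ler_wpM2l (mulr_ge0 (ler0n _ 2) C0) (e1 muc).
    have := ler_wpM2l D0 (e2 muc).
    lra.
  rewrite -mulr_suml mulrC; set T := (_ + _).
  have T0 : 0 <= T by rewrite addr_ge0// mulr_ge0 ?powR_ge0 ?mulr_ge0.
  have c20 : 0 < c / 2 by rewrite divr_gt0.
  have := ler_wpM2l T0 (@sum_powR_dist_le (c / 2) n j c20).
  by rewrite -/K /T; lra.
exists (2 * C), mu; split => //; first by rewrite mulr_ge0.
move=> j j1; apply/ler_addgt0Pr => e e0.
have [i ie] := half_pow_small (B * b `^ (mu * j%:R)) _ e0.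
apply: le_trans (iter i j j1) _; rewrite lerD2l.
by rewrite mulrAC.
Qed.

End geometric_decay.

(** * Isolating one frequency of a lacunary series *)

Section trigonometry.
Variable R : realType.
Implicit Types x y : R.

Lemma norm_sin_le x : `|sin x| <= `|x|.
Proof.
wlog x0 : x / 0 <= x => [hw|].
  have [x0|/ltW x0] := leP 0 x; first exact: hw.
  by rewrite -normrN -sinN -[leRHS]normrN; apply: hw; rewrite oppr_ge0.
have [->|xn0] := eqVneq x 0; first by rewrite sin0.
have xgt0 : 0 < x by rewrite lt_neqAle eq_sym xn0.
have [y _ e] : exists2 y, y \in `]0, x[%R & sin x - sin 0 = cos y * (x - 0).
  apply: (@MVT R sin cos) => //; apply: continuous_subspaceT => z; exact: continuous_sin.
move: e; rewrite sin0 !subr0 => ->; rewrite normrM ler_piMl//; exact: cos_max.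
Qed.

Lemma sin_sub x y : sin x - sin y = 2 * cos ((x + y) / 2) * sin ((x - y) / 2).
Proof.
transitivity (sin ((x + y) / 2 + (x - y) / 2) - sin ((x + y) / 2 - (x - y) / 2)).
  by congr (sin _ - sin _); field.
by rewrite sinB sinD; ring.
Qed.

Lemma norm_sin_sub_le x y : `|sin x - sin y| <= `|x - y|.
Proof.
rewrite sin_sub normrM normrM (ger0_norm (x := 2))//.
have := norm_sin_le ((x - y) / 2); rewrite normrM (ger0_norm (x := 2^-1))//.
have := cos_max ((x + y) / 2); have := normr_ge0 (sin ((x - y) / 2)); nra.
Qed.

(** Times [sin (t / 2)], each cosine is half the difference of the sines half a step to either side,
    and the sum telescopes. The product form also covers [sin (t / 2) = 0]. *)
Lemma dirichlet_cos (a t : R) n :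
  `|\sum_(i < n) cos (a + i%:R * t)| * `|sin (t / 2)| <= 1.
Proof.
rewrite -normrM.
have -> : (\sum_(i < n) cos (a + i%:R * t)) * sin (t / 2) =
    (sin (a + (n%:R - 2^-1) * t) - sin (a - 2^-1 * t)) / 2.
  elim: n => [|n IH]; first by rewrite big_ord0 !mul0r sub0r mulNr subrr mul0r.
  rewrite big_ord_recr/= mulrDl IH.
  have -> : a + (n.+1%:R - 2^-1) * t = (a + n%:R * t) + t / 2 by rewrite -natr1; field.
  have -> : a + (n%:R - 2^-1) * t = (a + n%:R * t) - t / 2 by field.
  rewrite (sinD _ (t / 2)) (sinB (a + n%:R * t) (t / 2)); field; rewrite ?andbT //.
rewrite normrM (ger0_norm (x := 2^-1))// ler_pdivrMr// mul1r.
apply: le_trans (ler_normB _ _) _.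
by rewrite (_ : 2 = 1 + 1)// lerD// sin_max.
Qed.

(** Oddness reduces to [|y|], and sine increases on [[0, 1]] because [1 <= pi / 2]. *)
Lemma sin_norm_ge x y : 0 <= x -> x <= `|y| -> `|y| <= 1 -> sin x <= `|sin y|.
Proof.
move=> x0 xy y1.
have p2 := pi_ge2 R; have p1 := pihalf_ge1 R.
have /andP[yN1 yle1] : -1 <= y <= 1 by rewrite -ler_norml.
have -> : `|sin y| = sin `|y|.
  have [y0|y0] := leP 0 y.
    by rewrite !ger0_norm//; apply: sin_ge0_pi; rewrite y0/=; lra.
  rewrite -[y in LHS]opprK sinN normrN (ltr0_norm y0).
  by rewrite ger0_norm//; apply: sin_ge0_pi; apply/andP; split; lra.
have y0 := normr_ge0 y.
by rewrite leNgt ltr_sin ?in_itv/= -?leNgt//; apply/andP; split; lra.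
Qed.

End trigonometry.

(** * Sampling along an arithmetic progression *)

Section lacunary.
Variables (R : realType) (b : R).
Hypothesis b_ge2 : 2 <= b.

Let b_gt1 : 1 < b. Proof. by apply: lt_le_trans b_ge2; rewrite ltr1n. Qed.
Let b_gt0 : 0 < b. Proof. exact: lt_trans b_gt1. Qed.
Let bX_gt0 j : 0 < b ^+ j. Proof. exact: exprn_gt0. Qed.

(** Twice the sum of [cos (b^k tau) * cos (b^j tau)] over the progression of [tau], turned by
    product-to-sum into two sums that the Dirichlet bound controls. *)
Definition window (N j k : nat) (alpha t0 : R) : R :=
  \sum_(i < N) (cos ((b ^+ k - b ^+ j) * (t0 + i%:R * (alpha / b ^+ j))) +
                cos ((b ^+ k + b ^+ j) * (t0 + i%:R * (alpha / b ^+ j)))).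

(** [sin (u (x + y)) - sin (u (x - y)) = 2 cos (u x) sin (u y)]: a symmetric increment separates the
    step [y] from the sampling point [x]. *)
Lemma windowed_increment (a : nat -> R) (n N j : nat) (alpha t0 y : R) :
  let F t := \sum_(1 <= k < n) a k * sin (b ^+ k * t) in
  let tau (i : nat) := t0 + i%:R * (alpha / b ^+ j) in
  \sum_(i < N) cos (b ^+ j * tau i) * (F (tau i + y) - F (tau i - y)) =
  \sum_(1 <= k < n) a k * (sin (b ^+ k * y) * window N j k alpha t0).
Proof.
move=> F tau.
under eq_bigr do rewrite /F -sumrB mulr_sumr.
rewrite exchange_big/=; apply: eq_bigr => k _.
rewrite mulrA mulr_sumr; apply: eq_bigr => i _; rewrite -/(tau i).
set u := b ^+ k; set v := b ^+ j; set x := tau i.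
rewrite (mulrDr u x y) (mulrBr u x y) (sinD (u * x)) (sinB (u * x)).
rewrite (mulrBl x u v) (mulrDl u v x) (cosB (u * x)) (cosD (u * x)).
ring.
Qed.

(** The two bounds on [|t|] put [|t / 2|] in [[alpha / 4, 1]], where sine is increasing, so the
    Dirichlet denominator is at least [sin (alpha / 4)]. *)
Lemma dirichlet_cos_le (x t alpha : R) N : 0 < alpha -> alpha / 2 <= `|t| -> `|t| <= 2 ->
  `|\sum_(i < N) cos (x + i%:R * t)| <= (sin (alpha / 4))^-1.
Proof.
move=> al0 alt t2.
have p2 := pi_ge2 R.
have s0 : 0 < sin (alpha / 4) by apply: sin_gt0_pi; apply/andP; split; lra.
have st : sin (alpha / 4) <= `|sin (t / 2)|.
  apply: sin_norm_ge; rewrite ?normrM ?(ger0_norm (x := 2^-1))//; lra.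
rewrite -[leRHS]mul1r ler_pdivlMr//; apply: le_trans _ (dirichlet_cos _ x t N).
by rewrite ler_wpM2l.
Qed.

Lemma window_term (sg alpha t0 : R) (j k i : nat) :
  (b ^+ k + sg * b ^+ j) * (t0 + i%:R * (alpha / b ^+ j)) =
  (b ^+ k + sg * b ^+ j) * t0 + i%:R * ((b ^+ k / b ^+ j + sg) * alpha).
Proof. by field; rewrite gt_eqF. Qed.

(** Together with [ratio_ge2], this uses [2 <= b] to keep the ratio of distinct frequencies away
    from 1. *)
Lemma ratio_le_half (j k : nat) : (k < j)%N -> b ^+ k / b ^+ j <= 2^-1.
Proof.
move=> kj; rewrite ler_pdivrMr// -(subnK (ltnW kj)) exprD.
have : b ^+ 1 <= b ^+ (j - k) by apply: ler_weXn2l; [exact: ltW|rewrite subn_gt0].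
rewrite expr1 => bjk.
have := ler_wpM2r (ltW (bX_gt0 k)) (le_trans b_ge2 bjk); lra.
Qed.

Lemma ratio_ge2 (j k : nat) : (j < k)%N -> 2 <= b ^+ k / b ^+ j.
Proof.
move=> /ratio_le_half; have := bX_gt0 k; have := bX_gt0 j => j0 k0.
by rewrite ler_pdivrMr// ler_pdivlMr// ler_pdivlMl.
Qed.

(** With [th = b^(k-j)] and [al = b^(-m)], the two progressions have steps [(th - 1) * al] and
    [(th + 1) * al]. Off the diagonal [|th - 1| >= 1/2], and [k <= j + m] gives [th * al <= 1], so
    both steps have size in [[al / 2, 2]]. The bound does not grow with [N]. *)
Lemma norm_window_le (N j k m : nat) (t0 : R) : (1 <= m)%N -> (k <= j + m)%N -> k != j ->
  `|window N j k (b ^- m) t0| <= 2 / sin (b ^- m / 4).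
Proof.
move=> m1 kjm kj; set al := b ^- m.
have al0 : 0 < al by rewrite invr_gt0.
have al2 : al <= 2^-1.
  rewrite lef_pV2 ?posrE//; apply: le_trans b_ge2 _.
  by rewrite -[leLHS]expr1; apply: ler_weXn2l; [exact: ltW|].
set th := b ^+ k / b ^+ j.
have th0 : 0 < th by rewrite divr_gt0.
have thal : th * al <= 1.
  rewrite /th /al -mulrA -invfM -exprD ler_pdivrMr// mul1r.
  by apply: ler_weXn2l; [exact: ltW|].
have thP : th <= 2^-1 \/ 2 <= th.
  have [|kj'|/eqP] := ltngtP k j; last by rewrite (negbTE kj).
    by move=> /ratio_le_half; left.
  by right; exact: ratio_ge2.
rewrite /window big_split/=; apply: le_trans (ler_normD _ _) _.
rewrite mulr_natl mulr2n lerD//.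
  have [lo hi] : 2^-1 <= `|th + -1| /\ `|th + -1| <= 1 + th.
    by case: thP => h; [rewrite ltr0_norm|rewrite ger0_norm]; try split; lra.
  under eq_bigr do rewrite -[- b ^+ j]mulN1r window_term.
  apply: dirichlet_cos_le => //; rewrite -/th normrM (gtr0_norm al0).
    by rewrite mulrC ler_wpM2r// ltW.
  by have := ler_wpM2r (ltW al0) hi; rewrite mulrDl mul1r; lra.
under eq_bigr do rewrite -[X in _ + X]mul1r window_term.
apply: dirichlet_cos_le => //; rewrite -/th normrM (gtr0_norm al0) ger0_norm; try lra.
all: by have := mulr_ge0 (ltW th0) (ltW al0); rewrite mulrDl mul1r; lra.
Qed.

Lemma norm_window_le_triv (N j k : nat) (alpha t0 : R) :
  `|window N j k alpha t0| <= 2 * N%:R.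
Proof.
apply: le_trans (ler_norm_sum _ _ _) _.
rewrite mulr_natr -[X in _ *+ X]card_ord -sumr_const; apply: ler_sum => i _.
by apply: le_trans (ler_normD _ _) _; rewrite (_ : 2 = 1 + 1)// lerD// cos_max.
Qed.

(** At [k = j] the difference frequency vanishes and contributes exactly [N]; only the progression
    of step [2 * b^(-m)] remains. *)
Lemma norm_window_diag_le (N j m : nat) (t0 : R) : (1 <= m)%N ->
  `|window N j j (b ^- m) t0 - N%:R| <= (sin (b ^- m / 4))^-1.
Proof.
move=> m1; set al := b ^- m.
have al0 : 0 < al by rewrite invr_gt0.
have al1 : al <= 1 by rewrite invf_le1// exprn_ege1// ltW.
rewrite /window big_split/=.
under eq_bigr do rewrite subrr mul0r cos0.
rewrite sumr_const card_ord addrAC subrr add0r.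
under eq_bigr do rewrite -[X in _ + X]mul1r window_term.
by apply: dirichlet_cos_le => //; rewrite divff ?gt_eqF// normrM (gtr0_norm al0) ger0_norm//; lra.
Qed.

End lacunary.

(** * Estimating one coefficient by an averaged increment *)

Section lacunary_decay.
Variables (R : realType) (b : R).
Hypothesis b_ge2 : 2 <= b.

Let b_gt1 : 1 < b. Proof. by apply: lt_le_trans b_ge2; rewrite ltr1n. Qed.
Let b_gt0 : 0 < b. Proof. exact: lt_trans b_gt1. Qed.

(* [pi / 2 / b^j] is a half step, so the sine factor is 1 at [k = j]. *)
Lemma window_remainder_le (h c delta t0 : R) (m N j k : nat) :
  0 < h < 1 -> 0 < c -> 2 * c <= h -> 2 * c <= 1 - h -> (1 <= m)%N ->
  b `^ (- (h / 2 * m%:R)) <= delta -> (sin (b ^- m / 4))^-1 <= delta * N%:R ->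
  b `^ (- (k%:R * h)) *
    `|sin (b ^+ k * (pi / 2 / b ^+ j)) * window R b N j k (b ^- m) t0 - (k == j)%:R * N%:R|
  <= 4 * delta * N%:R * b `^ (- (j%:R * h)) * b `^ (- (c * `|k%:R - j%:R|)).
Proof.
move=> /andP[h0 h1] c0 ch c1h m1 mdelta Ndelta.
have delta0 : 0 <= delta by apply: le_trans mdelta; exact: powR_ge0.
have N0 : 0 <= N%:R :> R by [].
have DN0 : 0 <= delta * N%:R by exact: mulr_ge0.
have bX j' : b ^+ j' = b `^ j'%:R by rewrite powR_mulrn// ltW.
have ratioE k' : b ^+ k' * (pi / 2 / b ^+ j) = b ^+ k' / b ^+ j * (pi / 2).
  by rewrite mulrCA mulrA [RHS]mulrC mulrA.
have [->|kj] := eqVneq k j.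
  rewrite ratioE divff ?expf_neq0 ?gt_eqF// mul1r sin_pihalf !mul1r subrr normr0 mulr0 oppr0.
  rewrite powRr0 mulr1 mulrC ler_wpM2r ?powR_ge0//.
  apply: le_trans (norm_window_diag_le _ _ b_ge2 _ _ _ _ m1) _.
  by apply: le_trans Ndelta _; lra.
set w := window _ _ _ _ _ _ _.
rewrite mul0r subr0 normrM.
have [kjm|jmk] := leqP k (j + m).
  have wle : `|w| <= 2 * (delta * N%:R).
    apply: le_trans (norm_window_le _ _ b_ge2 _ _ _ _ _ m1 kjm kj) _.
    by rewrite ler_wpM2l.
  move: kj; rewrite neq_ltn => /orP[kj|jk].
    (* Low frequencies: the increment gains [b^(-(j-k))] against the loss [b^((j-k)h)], and
       [c <= 1 - h] leaves the required decay. *)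
    have sle : `|sin (b ^+ k * (pi / 2 / b ^+ j))| <= 2 * b `^ (- (j%:R - k%:R)).
      apply: le_trans (norm_sin_le _ _) _; rewrite ratioE.
      rewrite !bX -powRN -powRDgt0// normrM ger0_norm ?powR_ge0//.
      rewrite (_ : k%:R + - j%:R = - (j%:R - k%:R)); last by ring.
      rewrite mulrC ler_wpM2r ?powR_ge0//.
      by rewrite ger0_norm ?divr_ge0 ?pi_ge0//; exact: ltW (pihalf_lt2 _).
    have pw : b `^ (- (k%:R * h)) * b `^ (- (j%:R - k%:R)) <=
       b `^ (- (j%:R * h)) * b `^ (- (c * `|k%:R - j%:R|)).
      rewrite -!powRDgt0//; apply: ler_powR; first exact: ltW.
      rewrite distrC ger0_norm ?subr_ge0 ?ler_nat 1?ltnW//.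
      have : k%:R <= j%:R :> R by rewrite ler_nat ltnW.
      rewrite -subr_ge0; set x := _ - _ => x0.
      have -> : j%:R = k%:R + x by rewrite /x; ring.
      nra.
    have := ler_pM (normr_ge0 _) (normr_ge0 _) sle wle.
    move=> /(ler_wpM2l (powR_ge0 b (- (k%:R * h)))).
    have := ler_wpM2l DN0 pw.
    lra.
  (* Frequencies with [j < k <= j + m]: the amplitude supplies the decay, as [c <= h], and the
     window supplies [delta * N]. *)
  have pw : b `^ (- (k%:R * h)) <= b `^ (- (j%:R * h)) * b `^ (- (c * `|k%:R - j%:R|)).
    rewrite -!powRDgt0//; apply: ler_powR; first exact: ltW.
    have : j%:R <= k%:R :> R by rewrite ler_nat ltnW.
    rewrite -subr_ge0 => x0; rewrite ger0_norm//.
    nra.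
  have := ler_pM (normr_ge0 _) (normr_ge0 _) (sin_max (b ^+ k * (pi / 2 / b ^+ j))) wle.
  move=> /(ler_wpM2l (powR_ge0 b (- (k%:R * h)))).
  have := ler_wpM2l DN0 pw.
  have := mulr_ge0 DN0 (powR_ge0 b (- (j%:R * h) - c * `|k%:R - j%:R|)).
  rewrite powRDgt0//.
  lra.
(* High frequencies, [k > j + m]: the window has only its trivial bound, so the amplitude does both
   jobs. Half of [h] yields [delta] because [k - j > m], and the other half yields the decay because
   [c <= h / 2]. *)
have pw : b `^ (- (k%:R * h)) <=
   delta * (b `^ (- (j%:R * h)) * b `^ (- (c * `|k%:R - j%:R|))).
  apply: le_trans (ler_wpM2r _ mdelta); last by rewrite mulr_ge0// powR_ge0.
  rewrite -!powRDgt0//; apply: ler_powR; first exact: ltW.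
  have : j%:R + m%:R <= k%:R :> R by rewrite -natrD ler_nat ltnW.
  have m0 : 0 <= m%:R :> R by [].
  move=> jmk'; rewrite ger0_norm; last by lra.
  have : 0 <= k%:R - (j%:R + m%:R) :> R by rewrite subr_ge0.
  nra.
have := norm_window_le_triv R b N j k (b ^- m) t0; rewrite -/w => wle.
have := ler_pM (normr_ge0 _) (normr_ge0 _) (sin_max (b ^+ k * (pi / 2 / b ^+ j))) wle.
move=> /(ler_wpM2l (powR_ge0 b (- (k%:R * h)))).
have := ler_wpM2r N0 pw.
have := mulr_ge0 DN0 (powR_ge0 b (- (j%:R * h) - c * `|k%:R - j%:R|)).
rewrite powRDgt0//.
lra.
Qed.

(** The windowed identity is solved for its [j]-th term. *)
Lemma lacunary_coef_le (h c delta t0 : R) (m N j n : nat) (z : nat -> R) :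
  0 < h < 1 -> 0 < c -> 2 * c <= h -> 2 * c <= 1 - h -> (1 <= m)%N ->
  b `^ (- (h / 2 * m%:R)) <= delta -> (sin (b ^- m / 4))^-1 <= delta * N%:R ->
  (1 <= j < n)%N ->
  let F t := \sum_(1 <= k < n) z k * b `^ (- (k%:R * h)) * sin (b ^+ k * t) in
  let tau (i : nat) := t0 + i%:R * (b ^- m / b ^+ j) in
  let y := pi / 2 / b ^+ j in
  N%:R * b `^ (- (j%:R * h)) * `|z j| <=
   `|\sum_(i < N) cos (b ^+ j * tau i) * (F (tau i + y) - F (tau i - y))| +
   4 * delta * N%:R * b `^ (- (j%:R * h)) *
     \sum_(1 <= k < n) `|z k| * b `^ (- (c * `|k%:R - j%:R|)).
Proof.
move=> h01 c0 ch c1h m1 mdelta Ndelta jn; cbv zeta.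
have := windowed_increment R b (fun k => z k * b `^ (- (k%:R * h))) n N j (b ^- m) t0.
move=> /(_ (pi / 2 / b ^+ j)); cbv zeta => ->; set y := pi / 2 / b ^+ j.
(* Deviation from the ideal filter, which would return [N] at [k = j] and 0 elsewhere. *)
pose rem k := sin (b ^+ k * y) * window R b N j k (b ^- m) t0 - (k == j)%:R * N%:R.
set S := \sum_(1 <= k < n) _ * _.
have eS : z j * b `^ (- (j%:R * h)) * N%:R =
    S - \sum_(1 <= k < n) z k * b `^ (- (k%:R * h)) * rem k.
  rewrite /S -sumrB.
  rewrite (bigD1_seq j) ?mem_index_iota ?iota_uniq//= big1 => [|k kj].
    by rewrite addr0 /rem eqxx mulr1n; ring.
  by rewrite /rem (negbTE kj) mulr0n; ring.
have -> : N%:R * b `^ (- (j%:R * h)) * `|z j| = `|z j * b `^ (- (j%:R * h)) * N%:R|.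
  by rewrite !normrM (ger0_norm (powR_ge0 _ _)) (ger0_norm (ler0n R N)); ring.
rewrite eS; apply: le_trans (ler_normB _ _) _; rewrite lerD2l.
apply: le_trans (ler_norm_sum _ _ _) _; rewrite mulr_sumr; apply: ler_sum => k _.
rewrite !normrM (ger0_norm (powR_ge0 _ _)).
have := window_remainder_le h c delta t0 m N j k h01 c0 ch c1h m1 mdelta Ndelta.
move=> /(ler_wpM2l (normr_ge0 (z k))); rewrite -/y -/(rem k); lra.
Qed.

End lacunary_decay.

(** * Decay of the coefficients from Hoelder regularity at one point *)

Section lacunary_series.
Variables (R : realType) (b : R).
Hypothesis b_ge2 : 2 <= b.

Let b_gt1 : 1 < b. Proof. by apply: lt_le_trans b_ge2; rewrite ltr1n. Qed.
Let b_gt0 : 0 < b. Proof. exact: lt_trans b_gt1. Qed.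

Lemma exists_nat_ge (x : R) : exists2 m : nat, (1 <= m)%N & x <= m%:R.
Proof.
exists (Num.bound `|x|).+1 => //.
apply: le_trans (ler_norm _) _; apply: le_trans (ltW (archi_boundP _)) _ => //.
by rewrite ler_nat.
Qed.

Lemma powRN_small (x e : R) : 0 < x -> 0 < e ->
  exists2 m : nat, (1 <= m)%N & b `^ (- (x * m%:R)) <= e.
Proof.
move=> x0 e0; have [C C0 hC] := sqr_nat_le_powR _ _ b_gt1 x x0.
have [m m1 Cm] := exists_nat_ge (C / e).
exists m => //; rewrite powRN -[leLHS]mul1r ler_pdivrMr ?powR_gt0//.
rewrite ler_pdivrMr// in Cm.
have m1' : 1 <= m%:R :> R by rewrite ler1n.
have := hC m; set B := b `^ _ => hB.
have : C * 1 <= C * (e * B).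
  have mm : m%:R <= (1 + m%:R) ^+ 2 :> R by nra.
  have := ler_wpM2l (ltW e0) mm; have := ler_wpM2l (ltW e0) hB; lra.
by rewrite ler_pM2l.
Qed.

(** The extra factor [1 + j] pays for varying the exponent, as in [powRN_lipschitz]. *)
Lemma linear_growth_subexp (z : nat -> R) (A : R) : 0 <= A ->
  (forall j, `|z j| <= A * (1 + j%:R)) ->
  forall eta, 0 < eta -> exists2 B : R, 0 <= B &
    forall j, `|z j| * (1 + j%:R) <= B * b `^ (eta * j%:R).
Proof.
move=> A0 zA eta eta0; have [C C0 hC] := sqr_nat_le_powR _ _ b_gt1 eta eta0.
exists (A * C) => [|j]; first by rewrite mulr_ge0// ltW.
have j0 : 0 <= 1 + j%:R :> R by rewrite addr_ge0.
apply: le_trans (ler_wpM2r j0 (zA j)) _.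
by rewrite -!mulrA ler_wpM2l// -expr2.
Qed.

Lemma lacunary_decay (h h' A C r t0 : R) (z : nat -> R) (Y : R -> R) :
  0 < h < 1 -> h < h' -> 0 <= A -> 0 <= C -> 0 < r ->
  (forall j, `|z j| <= A * (1 + j%:R)) ->
  (forall t, (fun n => \sum_(1 <= k < n) z k * b `^ (- (k%:R * h)) * sin (b ^+ k * t)) @ \oo
     --> Y t) ->
  (forall t, `|t - t0| < r -> `|Y t - Y t0| <= C * `|t - t0| `^ h') ->
  exists A' mu : R, [/\ 0 <= A', 0 < mu &
    forall j, (1 <= j)%N -> `|z j| <= A' * b `^ (- (mu * j%:R))].
Proof.
move=> h01 hh' A0 C0 r0 zA cvgY holdY; have /andP[h0 h1] := h01.
pose c := Num.min h (1 - h) / 2.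
have c0 : 0 < c by rewrite divr_gt0// lt_min h0 subr_gt0.
have ch : 2 * c <= h by rewrite mulrC divfK// ge_min lexx.
have c1h : 2 * c <= 1 - h by rewrite mulrC divfK// ge_min lexx orbT.
pose K := 2 / (1 - b `^ (- (c / 2))).
have K0 : 0 < K by rewrite divr_gt0// subr_gt0 powRN_lt1// divr_gt0.
(* Makes [4 * delta * K = 1/2], the contraction that [geometric_decay] asks for. Then [m] is chosen
   to damp the high frequencies, and [N], depending on [m], to make the Dirichlet bound at most
   [delta * N]. *)
pose delta := (8 * K)^-1.
have delta0 : 0 < delta by rewrite invr_gt0 mulr_gt0.
have h20 : 0 < h / 2 by rewrite divr_gt0.
have [m m1 mdelta] := powRN_small _ _ h20 delta0.
pose s0 := sin (b ^- m / 4).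
have [N N1 Ns] := exists_nat_ge (s0^-1 / delta).
rewrite ler_pdivrMr// mulrC in Ns.
have Npos : 0 < N%:R :> R by rewrite ltr0n.
pose al := b ^- m.
have al0 : 0 < al by rewrite invr_gt0 exprn_gt0.
(* All points [tau i + y] and [tau i - y] lie within [rho / b^j] of [t0]; the 2 bounds [pi / 2]. *)
pose rho := N%:R * al + 2.
have rho0 : 0 < rho by rewrite addr_gt0// mulr_gt0.
have h'0 : 0 < h' by exact: lt_trans hh'.
have kappa0 : 0 < h' - h by rewrite subr_gt0.
have [B B0 zB] := linear_growth_subexp _ _ A0 zA 1 ltr01.
pose C1 := 2 * C * rho `^ h'.
pose C2 := B * (rho / r) `^ (1 + (h' - h)).
have C10 : 0 <= C1 by rewrite !mulr_ge0// powR_ge0.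
have C20 : 0 <= C2 by rewrite mulr_ge0// powR_ge0.
apply: (@geometric_decay _ _ b_gt1 (fun j => `|z j|) (C1 + C2) (4 * delta) c (h' - h)) => //.
- by rewrite addr_ge0.
- by rewrite mulr_ge0// ltW.
- rewrite -/K /delta le_eqVlt; apply/orP; left; apply/eqP.
  by field; rewrite gt_eqF.
- move=> eta eta0; have [D D0 zD] := linear_growth_subexp _ _ A0 zA _ eta0.
  exists D => // k _; apply: le_trans _ (zD k).
  by rewrite ler_peMr// lerDl.
move=> j S j1 hS.
have S0 : 0 <= S by have := hS 0%N; rewrite big_geq.
have bj0 : 0 < b ^+ j by rewrite exprn_gt0.
have bjE : b ^+ j = b `^ j%:R by rewrite powR_mulrn// ltW.
(* If [rho / b^j >= r] the sampling points may leave the ball. Then [b^j <= rho / r], and [C2] turns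
   the crude bound on [z j] into the required one. *)
have [rhor|rhor] := ltP (rho / b ^+ j) r; last first.
  have : `|z j| <= C2 * b `^ (- ((h' - h) * j%:R)).
    apply: (@le_trans _ _ (B * b `^ (1 * j%:R))).
      by apply: le_trans _ (zB j); rewrite ler_peMr// lerDl.
    rewrite /C2 -mulrA ler_wpM2l// mul1r.
    have -> : b `^ j%:R = (b `^ j%:R) `^ (1 + (h' - h)) * b `^ (- ((h' - h) * j%:R)).
      by rewrite -powRrM -powRDgt0//; congr (_ `^ _); ring.
    rewrite ler_wpM2r ?powR_ge0//; apply: ge0_ler_powR.
    - by rewrite addr_ge0// ltW.
    - by rewrite nnegrE powR_ge0.
    - by rewrite nnegrE divr_ge0// ltW.
    by rewrite ler_pdivlMr// -bjE mulrC -ler_pdivlMr.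
  have := mulr_ge0 C10 (powR_ge0 b (- ((h' - h) * j%:R))).
  have := mulr_ge0 (ltW delta0) S0.
  lra.
pose F n t := \sum_(1 <= k < n) z k * b `^ (- (k%:R * h)) * sin (b ^+ k * t).
pose tau (i : nat) := t0 + i%:R * (al / b ^+ j).
pose y := pi / 2 / b ^+ j.
pose I n := \sum_(i < N) cos (b ^+ j * tau i) * (F n (tau i + y) - F n (tau i - y)).
pose L := \sum_(i < N) cos (b ^+ j * tau i) * (Y (tau i + y) - Y (tau i - y)).
have cvgI : I n @[n --> \oo] --> L.
  apply: cvg_big => [|i _]; [exact: add_continuous|].
  by apply: cvgMr; apply: cvgB; exact: cvgY.
have LC : `|L| <= N%:R * (2 * C * (rho / b ^+ j) `^ h').
  apply: le_trans (ler_norm_sum _ _ _) _.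
  rewrite mulr_natl -[X in _ *+ X]card_ord -sumr_const; apply: ler_sum => i _.
  rewrite normrM; apply: le_trans (ler_piMl _ (cos_max _)) _ => //.
  have near (x : R) : `|x| <= 2 / b ^+ j ->
      `|Y (tau i + x) - Y t0| <= C * (rho / b ^+ j) `^ h'.
    move=> xy.
    have tx : `|tau i + x - t0| <= rho / b ^+ j.
      rewrite /tau addrAC [t0 + _]addrC addrK /rho mulrDl -mulrA.
      apply: le_trans (ler_normD _ _) _; rewrite lerD//.
      have alb : 0 < al / b ^+ j by rewrite divr_gt0.
      by rewrite ger0_norm ?(mulr_ge0 (ler0n _ _) (ltW alb))// ler_pM2r// ler_nat ltnW.
    apply: le_trans (holdY _ (le_lt_trans tx rhor)) _.
    rewrite ler_wpM2l//; apply: ge0_ler_powR => //; rewrite ?nnegrE ?divr_ge0 ?ltW//.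
  have y2 : `|y| <= 2 / b ^+ j.
    rewrite /y ger0_norm ?divr_ge0 ?pi_ge0 ?ltW//.
    by rewrite ltr_pM2r ?invr_gt0// pihalf_lt2.
  have := near y y2; have := near (- y); rewrite normrN => /(_ y2).
  rewrite (_ : Y (tau i + y) - Y (tau i - y) =
    (Y (tau i + y) - Y t0) - (Y (tau i - y) - Y t0)); last by ring.
  have := ler_normB (Y (tau i + y) - Y t0) (Y (tau i - y) - Y t0).
  lra.
pose W := 4 * delta * N%:R * b `^ (- (j%:R * h)).
have W0 : 0 <= W by rewrite !mulr_ge0 ?powR_ge0// ltW.
(* [S] bounds every partial sum, so the estimate at finite [n] passes to the limit. *)
have main : N%:R * b `^ (- (j%:R * h)) * `|z j| - W * S <= `|L|.
  apply: (cvgr_to_ge (cvg_norm cvgI)); near=> n.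
  rewrite lerBlDr.
  have jn : (1 <= j < n)%N by rewrite j1; near: n; exact: nbhs_infty_gt.
  have := lacunary_coef_le _ b b_ge2 h c delta t0 m N j n z h01 c0 ch c1h m1 mdelta Ns jn.
  cbv zeta => /le_trans; apply; rewrite lerD2l -/W.
  by rewrite ler_wpM2l.
have D0 : 0 < N%:R * b `^ (- (j%:R * h)) by rewrite mulr_gt0// powR_gt0.
rewrite -(ler_pM2l D0).
have C1E : N%:R * (2 * C * (rho / b ^+ j) `^ h') =
    N%:R * b `^ (- (j%:R * h)) * (C1 * b `^ (- ((h' - h) * j%:R))).
  rewrite powRM ?invr_ge0 ?ltW// bjE -powRN -powRrM.
  have -> : b `^ (- j%:R * h') = b `^ (- (j%:R * h)) * b `^ (- ((h' - h) * j%:R)).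
    by rewrite -powRDgt0//; congr (_ `^ _); ring.
  by rewrite /C1; ring.
have := mulr_ge0 (ltW D0) (mulr_ge0 C20 (powR_ge0 b (- ((h' - h) * j%:R)))).
move: main LC; rewrite C1E /W; lra.
Unshelve. all: by end_near. Qed.

End lacunary_series.

(** * Local behaviour of the paths *)

Section weierstrass_paths.
Variables (R : realType) (b : R).
Hypothesis b_ge2 : 2 <= b.

Let b_gt1 : 1 < b. Proof. by apply: lt_le_trans b_ge2; rewrite ltr1n. Qed.
Let b_gt0 : 0 < b. Proof. exact: lt_trans b_gt1. Qed.
Let lnb_ge0 : 0 <= ln b. Proof. by rewrite ln_ge0// ltW. Qed.

Lemma cvgn_abs_bounded (u : nat -> R) (C : R) :
  (forall n, \sum_(1 <= j < n) `|u j| <= C) -> cvgn (fun n => \sum_(1 <= j < n) u j).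
Proof.
(* The sums start at 1 whereas [series] starts at 0, hence the padding. *)
move=> uC; pose v j := if j == 0%N then 0 else u j.
have sumE (f : R -> R) n : f 0 = 0 -> \sum_(0 <= j < n) f (v j) = \sum_(1 <= j < n) f (u j).
  move=> f0; case: n => [|n]; first by rewrite !big_geq.
  rewrite big_ltn// {1}/v eqxx f0 add0r.
  by apply: eq_big_nat => -[].
have -> : (fun n => \sum_(1 <= j < n) u j) = series v.
  by apply/funext => n; rewrite /series/= (sumE id).
apply: normed_cvg; apply: nondecreasing_is_cvgn.
  by apply: nondecreasing_series => k _ _; exact: normr_ge0.
exists C => _ [n _ <-]; apply: le_trans _ (uC n).
by rewrite -(sumE Num.norm) ?normr0.
Qed.

Lemma norm_lim_le (u : nat -> R) (l C : R) :
  u @ \oo --> l -> (forall n, `|u n| <= C) -> `|l| <= C.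
Proof. by move=> ul uC; apply: (cvgr_to_le (cvg_norm ul)); exact: nearW. Qed.

(** Interpolates between the Lipschitz bound, for [|x - y| <= 1], and the trivial bound 2. *)
Lemma norm_sin_sub_powR (a x y : R) : 0 < a <= 1 -> `|sin x - sin y| <= 2 * `|x - y| `^ a.
Proof.
move=> /andP[a0 a1]; have [xy1|xy1] := leP `|x - y| 1.
  apply: le_trans (norm_sin_sub_le _ _ _) _.
  have [->|xy0] := eqVneq `|x - y| 0; first by rewrite mulr_ge0 ?powR_ge0.
  apply: (@le_trans _ _ (`|x - y| `^ a)).
    by apply: ger1_powR => //; rewrite xy1 andbT lt_def xy0 normr_ge0.
  by rewrite ler_peMl ?powR_ge0// ler1n.
apply: le_trans (ler_normB _ _) _.
apply: (@le_trans _ _ (2 * 1)); first by rewrite mulr1 (_ : 2 = 1 + 1)// lerD// sin_max.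
have one_a : 1 `^ a = 1 :> R by rewrite powR1.
rewrite ler_wpM2l// -[leLHS]one_a; apply: ge0_ler_powR; rewrite ?nnegrE//; exact: ltW.
Qed.

Variables (z : nat -> R) (A : R).
Hypothesis A_ge0 : 0 <= A.
Hypothesis zA : forall j, `|z j| <= A * (1 + j%:R).

(** Half of [eta] absorbs the growth of the coefficients; the other half sums as a geometric
    series. *)
Lemma weighted_sum_le (eta : R) : 0 < eta -> exists2 M : R, 0 <= M &
  forall n, \sum_(1 <= j < n) `|z j| * (1 + j%:R) * b `^ (- (j%:R * eta)) <= M.
Proof.
move=> eta0; have eta20 : 0 < eta / 2 by rewrite divr_gt0.
have [B B0 zB] := linear_growth_subexp _ _ b_ge2 z A A_ge0 zA _ eta20.
exists (B * (2 / (1 - b `^ (- (eta / 2))))) => [|n].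
  by rewrite mulr_ge0// divr_ge0// subr_ge0 ltW// powRN_lt1.
apply: le_trans _ (ler_wpM2l B0 (sum_powR_dist_le _ _ b_gt1 _ n 0 eta20)).
rewrite mulr_sumr; apply: ler_sum => j _.
apply: le_trans (ler_wpM2r (powR_ge0 _ _) (zB j)) _.
rewrite -[leLHS]mulrA ler_wpM2l// -powRDgt0// subr0 ger0_norm//.
by apply: ler_powR; [exact: ltW|lra].
Qed.

Definition wsum (h : R -> R) (n : nat) (t : R) : R :=
  \sum_(1 <= j < n) z j * b `^ (- (j%:R * h t)) * sin (b ^+ j * t).

Lemma cvgn_wsum (h : R -> R) (t : R) : 0 < h t -> cvgn (fun n => wsum h n t).
Proof.
move=> h0; have [M M0 zM] := weighted_sum_le _ h0.
apply: (cvgn_abs_bounded _ M) => n; apply: le_trans _ (zM n).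
apply: ler_sum => j _; rewrite !normrM (ger0_norm (powR_ge0 _ _)).
have p0 := powR_ge0 b (- (j%:R * h t)).
apply: (@le_trans _ _ (`|z j| * b `^ (- (j%:R * h t)))).
  by rewrite ler_piMr ?mulr_ge0// sin_max.
rewrite ler_wpM2r// ler_peMr// lerDl//.
Qed.

Lemma wsum_freeze (m : R) : 0 < m -> exists2 M : R, 0 <= M &
  forall (h g : R -> R) (t : R), m <= h t -> m <= g t ->
    `|limn (fun n => wsum h n t) - limn (fun n => wsum g n t)| <= M * `|h t - g t|.
Proof.
move=> m0; have [M M0 zM] := weighted_sum_le _ m0.
exists (M * ln b) => [|h g t mh mg]; first by rewrite mulr_ge0.
have ch : cvgn (fun n => wsum h n t) by apply: cvgn_wsum; exact: lt_le_trans mh.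
have cg : cvgn (fun n => wsum g n t) by apply: cvgn_wsum; exact: lt_le_trans mg.
apply: (norm_lim_le _ _ _ (cvgB ch cg)) => n.
rewrite !fctE /wsum -sumrB; apply: le_trans (ler_norm_sum _ _ _) _.
have D0 : 0 <= ln b * `|h t - g t| by rewrite mulr_ge0.
rewrite -[leRHS]mulrA; apply: le_trans _ (ler_wpM2r D0 (zM n)).
rewrite mulr_suml; apply: ler_sum => j _.
rewrite -mulrBl -mulrBr !normrM.
apply: (@le_trans _ _ (`|z j| * `|b `^ (- (j%:R * h t)) - b `^ (- (j%:R * g t))|)).
  by rewrite ler_piMr ?mulr_ge0// sin_max.
have := ler_wpM2l (normr_ge0 (z j)) (powRN_lipschitz _ _ b_gt1 j m _ _ mh mg).
lra.
Qed.

Lemma wsum_frozen_holder (h a : R) : 0 < a < h -> h < 1 -> exists2 M : R, 0 <= M &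
  forall m t u, h <= m ->
    `|limn (fun n => wsum (fun=> m) n t) - limn (fun n => wsum (fun=> m) n u)| <=
    M * `|t - u| `^ a.
Proof.
move=> /andP[a0 ah] h1; have ha0 : 0 < h - a by rewrite subr_gt0.
have a01 : 0 < a <= 1 by rewrite a0 ltW// (lt_trans ah).
have [M M0 zM] := weighted_sum_le _ ha0.
exists (M * 2) => [|m t u hm]; first by rewrite mulr_ge0.
have m0 : 0 < m by apply: lt_le_trans hm; exact: lt_trans ah.
have ct : cvgn (fun n => wsum (fun=> m) n t) by exact: cvgn_wsum.
have cu : cvgn (fun n => wsum (fun=> m) n u) by exact: cvgn_wsum.
apply: (norm_lim_le _ _ _ (cvgB ct cu)) => n.
rewrite !fctE /wsum -sumrB; apply: le_trans (ler_norm_sum _ _ _) _.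
have D0 : 0 <= 2 * `|t - u| `^ a by rewrite mulr_ge0// powR_ge0.
rewrite -[leRHS]mulrA; apply: le_trans _ (ler_wpM2r D0 (zM n)).
rewrite mulr_suml; apply: ler_sum => j _.
rewrite -mulrBr !normrM (ger0_norm (powR_ge0 _ _)).
have hs : `|sin (b ^+ j * t) - sin (b ^+ j * u)| <= 2 * (b `^ (j%:R * a) * `|t - u| `^ a).
  apply: le_trans (norm_sin_sub_powR _ _ _ a01) _.
  rewrite -mulrBr normrM powRM// (ger0_norm (exprn_ge0 _ (ltW b_gt0))).
  by rewrite powRrM powR_mulrn// ltW.
have hp : b `^ (- (j%:R * m)) * b `^ (j%:R * a) <= (1 + j%:R) * b `^ (- (j%:R * (h - a))).
  apply: (@le_trans _ _ (b `^ (- (j%:R * (h - a))))).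
    rewrite -powRDgt0//; apply: ler_powR; first exact: ltW.
    have := ler_wpM2l (ler0n R j) hm; lra.
  by rewrite ler_peMl ?powR_ge0// lerDl.
have := ler_wpM2l (mulr_ge0 (normr_ge0 (z j)) (powR_ge0 b (- (j%:R * m)))) hs.
have := ler_wpM2l (mulr_ge0 (normr_ge0 (z j)) D0) hp.
lra.
Qed.

End weierstrass_paths.

(** * Local and pointwise regularity with a moving exponent *)

Section weierstrass_exponents.
Variables (R : realType) (b : R).
Hypothesis b_ge2 : 2 <= b.

Let b_gt1 : 1 < b. Proof. by apply: lt_le_trans b_ge2; rewrite ltr1n. Qed.
Let b_gt0 : 0 < b. Proof. exact: lt_trans b_gt1. Qed.

Variables (z : nat -> R) (A : R).
Hypothesis A_ge0 : 0 <= A.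
Hypothesis zA : forall j, `|z j| <= A * (1 + j%:R).

Variables (H : R -> R) (t0 beta CH r0 : R).
Let h := H t0.
Hypothesis h_gt0 : 0 < h.
Hypothesis h_beta : h < beta < 1.
Hypothesis CH_ge0 : 0 <= CH.
Hypothesis r0_gt0 : 0 < r0.
Hypothesis H_holder : forall t u, `|t - t0| < r0 -> `|u - t0| < r0 ->
  `|H t - H u| <= CH * `|t - u| `^ beta.

Let X t := limn (fun n => wsum R b z H n t).

Let beta_gt0 : 0 < beta. Proof. by case/andP: h_beta => + _; exact: lt_trans. Qed.

Lemma exponent_near_ge (m : R) : m < h -> exists r : R,
  [/\ 0 < r, r <= r0, r <= 2^-1 & forall t, `|t - t0| < r -> m <= H t].
Proof.
move=> mh; pose e := (h - m) / (CH + 1).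
have CH1 : 0 < CH + 1 by rewrite ltr_wpDl.
have e0 : 0 < e by rewrite divr_gt0// subr_gt0.
pose r := Num.min r0 (Num.min 2^-1 (e `^ beta^-1)).
have rr0 : r <= r0 by rewrite ge_min lexx.
have re : r <= e `^ beta^-1 by rewrite !ge_min lexx !orbT.
have r_gt0 : 0 < r by rewrite !lt_min r0_gt0 powR_gt0// invr_gt0 ltr0n.
exists r; split => // [|t tr]; first by rewrite !ge_min lexx orbT.
have tr0 : `|t - t0| < r0 by exact: lt_le_trans rr0.
have h1 := H_holder t t0 tr0; rewrite subrr normr0 in h1.
have h2 : `|t - t0| `^ beta <= e.
  have eE : e = (e `^ beta^-1) `^ beta.
    by rewrite -powRrM mulVf ?gt_eqF// powRr1// ltW.
  rewrite [leRHS]eE.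
  apply: ge0_ler_powR; rewrite ?nnegrE ?powR_ge0//; first exact: ltW.
  exact: ltW (lt_le_trans tr re).
have h3 : CH * e <= h - m.
  rewrite /e mulrCA ler_piMr ?subr_ge0 ?(ltW mh)//.
  by rewrite ler_pdivrMr// mul1r lerDl.
have := ler_wpM2l CH_ge0 h2.
have := ler_norm (- (H t - H t0)); rewrite normrN.
by have := h1 r0_gt0; rewrite /h in h3 *; lra.
Qed.

Lemma weierstrass_locally_holder (a : R) : 0 < a < h -> exists C r : R,
  [/\ 0 <= C, 0 < r & forall t u, `|t - t0| < r -> `|u - t0| < r ->
     `|X t - X u| <= C * `|t - u| `^ a].
Proof.
move=> /andP[a0 ah]; have /andP[hb b1] := h_beta.
pose m := (a + h) / 2.
have am : 0 < a < m by rewrite a0 /m; lra.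
have m1 : m < 1 by rewrite /m; lra.
have mh : m < h by rewrite /m; lra.
have m0 : 0 < m by case/andP: am; exact: lt_trans.
have [M1 M10 hM1] := wsum_frozen_holder _ _ b_ge2 z A A_ge0 zA _ _ am m1.
have [r [r_gt0 rr0 r2 Hm]] := exponent_near_ge _ mh.
have [M2 M20 hM2] := wsum_freeze _ _ b_ge2 z A A_ge0 zA _ m0.
exists (M1 + M2 * CH), r; split => //; first by rewrite addr_ge0// mulr_ge0.
move=> t u tr ur; have tH := Hm t tr; have uH := Hm u ur.
have tu1 : `|t - u| <= 1.
  rewrite (_ : t - u = (t - t0) - (u - t0)); last by ring.
  by have := ler_normB (t - t0) (u - t0); lra.
have frozen := hM1 (H t) t u tH.
have moving := hM2 (fun=> H t) H u tH uH.
have Htu : `|H t - H u| <= CH * `|t - u| `^ a.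
  apply: le_trans (H_holder t u (lt_le_trans tr rr0) (lt_le_trans ur rr0)) _.
  rewrite ler_wpM2l//; have [->|tu] := eqVneq `|t - u| 0.
    by rewrite !powR0// gt_eqF.
  by apply: ger_powR; [rewrite tu1 lt_def tu normr_ge0|lra].
rewrite /X; set Xt := limn _; set Xu := limn _.
set Yu := limn (fun n => wsum R b z (fun=> H t) n u) in frozen moving.
rewrite (_ : Xt - Xu = (Xt - Yu) + (Yu - Xu)); last by ring.
apply: le_trans (ler_normD _ _) _.
have := ler_wpM2l M20 Htu.
by have : `|Xt - Yu| <= M1 * `|t - u| `^ a by []; lra.
Qed.

Lemma weierstrass_pointwise_decay (h' C r : R) : h < h' -> 0 <= C -> 0 < r ->
  (forall t, `|t - t0| < r -> `|X t - X t0| <= C * `|t - t0| `^ h') ->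
  exists A' mu : R, [/\ 0 <= A', 0 < mu &
    forall j, (1 <= j)%N -> `|z j| <= A' * b `^ (- (mu * j%:R))].
Proof.
move=> hh' C0 r_gt0 holdX; have /andP[hb b1] := h_beta.
have h_lt1 : h < 1 by exact: lt_trans b1.
have m0 : 0 < h / 2 by rewrite divr_gt0.
have mh : h / 2 < h by lra.
have [M M0 hM] := wsum_freeze _ _ b_ge2 z A A_ge0 zA _ m0.
have [r1 [r1_gt0 r1r0 r12 Hm]] := exponent_near_ge _ mh.
pose h2 := Num.min h' beta.
pose Y t := limn (fun n => wsum R b z (fun=> h) n t).
apply: (@lacunary_decay R b b_ge2 h h2 A (C + M * CH) (Num.min r r1) t0 z Y) => //.
- by rewrite h_gt0 h_lt1.
- by rewrite lt_min hh' hb.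
- by rewrite addr_ge0// mulr_ge0.
- by rewrite lt_min r_gt0 r1_gt0.
- by move=> t; exact: (cvgn_wsum _ _ b_ge2 z A A_ge0 zA (fun=> h)).
move=> t; rewrite lt_min => /andP[tr tr1].
have tt0 := normr_ge0 (t - t0).
have t1 : `|t - t0| <= 1 by lra.
have pw p : h2 <= p -> `|t - t0| `^ p <= `|t - t0| `^ h2.
  move=> h2p; have h20 : 0 < h2 by rewrite lt_min beta_gt0 (lt_trans h_gt0).
  have [->|tn0] := eqVneq `|t - t0| 0.
    by rewrite !powR0// gt_eqF// (lt_le_trans h20).
  by apply: ger_powR => //; rewrite t1 lt_def tn0 normr_ge0.
have hX := le_trans (holdX t tr) (ler_wpM2l C0 (pw h' _)).
have YX : `|X t - Y t| <= M * (CH * `|t - t0| `^ h2).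
  apply: le_trans (hM H (fun=> h) t (Hm t tr1) (ltW mh)) _.
  rewrite ler_wpM2l//; apply: le_trans (H_holder t t0 _ _) _.
  - exact: lt_le_trans r1r0.
  - by rewrite subrr normr0.
  by rewrite ler_wpM2l// pw// ge_min lexx orbT.
have XY0 : X t0 = Y t0 by [].
rewrite -XY0 (_ : Y t - X t0 = (X t - X t0) - (X t - Y t)); last by ring.
apply: le_trans (ler_normB _ _) _.
by have := hX; rewrite ge_min lexx => /(_ isT); lra.
Qed.

End weierstrass_exponents.

(** * The 2-microlocal frontier *)

Section limsup_pairs.
Variable R : realType.

Lemma limf_esup_at_right_lty (g : R -> \bar R) :
  (limf_esup g (0 : R)^'+ < +oo)%E <->
  exists M r : R, 0 < r /\ forall rho, 0 < rho < r -> (g rho <= M%:E)%E.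
Proof.
split.
  move=> /ereal_inf_lt[_ [V V0 <-] supV].
  have [M VM] : exists M : R, (ereal_sup (g @` V) <= M%:E)%E.
    have := supV; case: (ereal_sup (g @` V)) => [x _|//|_]; first by exists x.
    by exists 0; rewrite leNye.
  move: V0 => /nbhs_ballP[r /= r0 hr]; exists M, r; split => // rho /andP[rho0 rhor].
  apply: le_trans VM; apply: ereal_sup_ubound; exists rho => //.
  by apply: hr => //; rewrite /ball/= sub0r normrN gtr0_norm.
move=> [M [r [r0 gM]]].
apply: (@le_lt_trans _ _ M%:E); last exact: ltry.
apply: (@le_trans _ _ (ereal_sup (g @` [set rho | 0 < rho < r]))).
  apply: ereal_inf_lbound; exists [set rho | 0 < rho < r] => //.
  near=> rho; apply/andP; split; near: rho; [exact: nbhs_right_gt|exact: nbhs_right_lt].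
by apply: ge_ereal_sup => _ [rho /= hrho <-]; exact: gM.
Unshelve. all: by end_near. Qed.

Lemma limsup_pairs_lty (q : R -> R * R -> R) (t0 : R) :
  (limf_esup (fun rho : R => ereal_sup
     [set (q rho p)%:E | p in distinct_pairs (nneg_ball t0 rho)]) (0 : R)^'+ < +oo)%E <->
  exists M r : R, 0 < r /\ forall rho p, 0 < rho < r ->
    distinct_pairs (nneg_ball t0 rho) p -> q rho p <= M.
Proof.
split=> [/limf_esup_at_right_lty|] [M [r [r0 qM]]].
  exists M, r; split => // rho p hrho dp; rewrite -lee_fin.
  by apply: le_trans (qM rho hrho); apply: ereal_sup_ubound; exists p.
apply/limf_esup_at_right_lty; exists M, r; split => // rho hrho.
by apply: ge_ereal_sup => _ [p dp <-]; rewrite lee_fin; exact: qM.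
Qed.

Lemma local_holder_exponent_gt (H : R -> R) (t0 h : R) : 0 < t0 -> h < 1 ->
  (h%:E < local_holder_exponent H t0)%E ->
  exists beta C r : R, [/\ h < beta < 1, 0 <= C, 0 < r &
    forall t u, `|t - t0| < r -> `|u - t0| < r -> `|H t - H u| <= C * `|t - u| `^ beta].
Proof.
move=> t00 h1 /ereal_sup_gt[_ [beta0 /= /limsup_pairs_lty[M [r [r0 HM]]] <-]].
rewrite lte_fin => hbeta0.
pose beta := Num.min beta0 ((h + 1) / 2).
pose rho := Num.min (r / 2) (Num.min t0 (2^-1)).
have rho0 : 0 < rho by rewrite !lt_min divr_gt0// t00/= invr_gt0.
have rhor : rho < r by rewrite gt_min ltr_pdivrMr// ltr_pMr// ltr1n.
have rhot : rho <= t0 by rewrite !ge_min lexx orbT.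
have rho2 : rho <= 2^-1 by rewrite !ge_min lexx !orbT.
exists beta, `|M|, rho; split => //.
  by rewrite lt_min hbeta0/= gt_min; apply/andP; split; [|apply/orP; right]; lra.
move=> t u tt0 ut0.
have [->|tu] := eqVneq t u; first by rewrite !subrr normr0 mulr_ge0// powR_ge0.
have tu0 : 0 < `|t - u| by rewrite normr_gt0 subr_eq0.
have := HM rho (t, u); rewrite rho0 rhor => /(_ isT) /=.
have nn x : `|x - t0| < rho -> 0 <= x by rewrite ltr_norml => /andP[]; lra.
have dp : distinct_pairs (nneg_ball t0 rho) (t, u).
  by split => /=; [split=> //; exact: nn|split=> //; exact: nn|exact/eqP].
move=> /(_ dp); rewrite ler_pdivrMr ?powR_gt0// => hM.
apply: (le_trans hM); apply: le_trans (ler_wpM2r (powR_ge0 _ _) (ler_norm M)) _.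
rewrite ler_wpM2l//; apply: ger_powR; last by rewrite ge_min lexx.
rewrite tu0/= (_ : t - u = (t - t0) - (u - t0)); last by ring.
by have := ler_normB (t - t0) (u - t0); lra.
Qed.

End limsup_pairs.

Section frontier.
Variables (R : realType) (f : R -> R) (t0 h : R).
Hypothesis t0_gt0 : 0 < t0.
Hypothesis h_gt0 : 0 < h.
Hypothesis locally_holder : forall a, 0 < a < h -> exists C r : R, [/\ 0 <= C, 0 < r &
  forall t u, `|t - t0| < r -> `|u - t0| < r -> `|f t - f u| <= C * `|t - u| `^ a].
Hypothesis pointwise_exponent : forall h' C r : R, h < h' -> 0 <= C -> 0 < r ->
  ~ (forall t, `|t - t0| < r -> `|f t - f t0| <= C * `|t - t0| `^ h').

Lemma microlocal_frontier_ge (s' sigma : R) : s' < 0 -> sigma < h + s' ->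
  (sigma%:E <= microlocal_frontier f t0 s')%E.
Proof.
move=> s0 sh; apply: ereal_sup_ubound; exists sigma => //=.
apply/limsup_pairs_lty.
pose a := Num.max (sigma - s') (h / 2).
have a0 : 0 < a by rewrite lt_max [X in _ || X]divr_gt0// orbT.
have ah : a < h by have := h_gt0; rewrite gt_max => hp; apply/andP; split; lra.
have sa : sigma - s' <= a by rewrite le_max lexx.
have [C [r [C0 r0 fC]]] := locally_holder _ (introT andP (conj a0 ah)).
exists (C * 2 `^ (a - sigma)), (Num.min r 1); split; first by rewrite lt_min r0/=.
move=> rho [t u] /andP[rho0]; rewrite lt_min => /andP[rhor rho1] [/= [t_ge0 tt0] [u_ge0 ut0]] tu.
have tu0 : 0 < `|t - u| by rewrite normr_gt0 subr_eq0; exact/eqP.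
have tu2 : `|t - u| <= 2 * rho.
  rewrite (_ : t - u = (t - t0) - (u - t0)); last by ring.
  by have := ler_normB (t - t0) (u - t0); lra.
have := fC t u (lt_trans tt0 rhor) (lt_trans ut0 rhor) => ftu.
rewrite ler_pdivrMr ?mulr_gt0 ?powR_gt0//; apply: le_trans ftu _.
rewrite -mulrA ler_wpM2l//.
have as0 : 0 <= a - sigma by lra.
have -> : `|t - u| `^ a = `|t - u| `^ sigma * `|t - u| `^ (a - sigma).
  rewrite -powRD; first by congr (_ `^ _); ring.
  by apply/implyP => _; rewrite gt_eqF.
rewrite mulrCA ler_wpM2l ?powR_ge0//.
apply: (@le_trans _ _ ((2 * rho) `^ (a - sigma))).
  by apply: ge0_ler_powR; rewrite ?nnegrE ?mulr_ge0// ltW.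
rewrite powRM ?(ltW rho0)// ler_wpM2l ?powR_ge0//.
by apply: ger_powR; [rewrite rho0 ltW|lra].
Qed.

Lemma microlocal_frontier_le (s' : R) : s' < 0 ->
  (microlocal_frontier f t0 s' <= (h + s')%:E)%E.
Proof.
move=> s0; apply: ge_ereal_sup => _ [sigma /= /limsup_pairs_lty[M [r [r0 fM]]] <-].
rewrite lee_fin leNgt; apply/negP => hs.
have hsigma : h < sigma - s' by lra.
pose rad := Num.min (r / 2) t0.
have rad0 : 0 < rad by rewrite lt_min t0_gt0 divr_gt0.
apply: (pointwise_exponent (sigma - s') (`|M| * 2 `^ (- s')) rad) => //.
move=> t; rewrite lt_min => /andP[tr tt0].
have [->|tnt0] := eqVneq t t0.
  by rewrite !subrr normr0 mulr_ge0 ?powR_ge0// mulr_ge0 ?powR_ge0.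
have tn : 0 < `|t - t0| by rewrite normr_gt0 subr_eq0.
have rhoP : 0 < 2 * `|t - t0| < r by rewrite mulr_gt0//= mulrC -ltr_pdivlMr.
have dp : distinct_pairs (nneg_ball t0 (2 * `|t - t0|)) (t, t0).
  split => /=.
  - split; first by move: tt0; rewrite ltr_norml => /andP[]; lra.
    by rewrite ltr_pMl// ltr1n.
  - by split; [exact: ltW|rewrite subrr normr0 mulr_gt0].
  - exact/eqP.
have := fM _ _ rhoP dp => /=; rewrite ler_pdivrMr ?mulr_gt0 ?powR_gt0 ?mulr_gt0// => hM.
apply: (le_trans hM); rewrite powRM//.
have -> : `|t - t0| `^ (sigma - s') = `|t - t0| `^ sigma * `|t - t0| `^ (- s').
  by rewrite -powRD//; apply/implyP => _; rewrite gt_eqF.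
set x := `|t - t0| `^ sigma; set y := _ `^ (- s'); set w := _ `^ (- s').
have xwy0 : 0 <= x * (y * w) by rewrite !mulr_ge0 ?powR_ge0.
have := ler_wpM2r xwy0 (ler_norm M); lra.
Qed.

Lemma microlocal_frontierE (s' : R) : s' < 0 ->
  microlocal_frontier f t0 s' = (h + s')%:E.
Proof.
move=> s0; apply/eqP; rewrite eq_le microlocal_frontier_le//=.
apply/lee_subgt0Pr => e e0; rewrite -EFinB.
by apply: microlocal_frontier_ge => //; lra.
Qed.

End frontier.

(** * Independent Gaussian coefficients *)

Section gaussian.
Variable R : realType.
Local Notation mu := (@lebesgue_measure R).

(* For [a < |x|] the density at [x] is at most [sqrt 2 exp(-a^2/4)] times the
   normal density of variance 2. *)
Lemma normal_prob_tail (a : R) : 0 <= a ->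
  (normal_prob 0 1 [set x : R | a < `|x|]%R <=
   (Num.sqrt 2 * expR (- (a ^+ 2 / 4)))%:E)%E.
Proof.
move=> a0; rewrite /normal_prob.
have s2 : Num.sqrt 2 != 0 :> R by rewrite gt_eqF// sqrtr_gt0.
have mA : measurable [set x : R | a < `|x|].
  rewrite (_ : [set x | _] = (Num.norm : R -> R) @^-1` `]a, +oo[%classic); last first.
    by apply/seteqP; split => x /=; rewrite in_itv/= andbT.
  have : measurable_fun setT (Num.norm : R -> R) by [].
  by rewrite -[X in measurable X]setTI; apply.
pose K := Num.sqrt 2 * expR (- (a ^+ 2 / 4)) : R.
have K0 : 0 <= K by rewrite mulr_ge0 ?expR_ge0// sqrtr_ge0.
have mf (s : R) (D : set R) : measurable_fun D (EFin \o normal_pdf 0 s).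
  by apply: measurable_funTS; apply/measurable_EFinP; exact: measurable_normal_pdf.
have pdf_le : (\int[mu]_(x in [set x : R | a < `|x|]%R) (normal_pdf 0 1 x)%:E <=
    \int[mu]_(x in [set x : R | a < `|x|]%R)
      (K%:E * (normal_pdf 0 (Num.sqrt 2) x)%:E))%E.
  apply: ge0_le_integral => //.
  - by move=> x _; rewrite lee_fin normal_pdf_ge0.
  - exact: mf.
  - by apply: emeasurable_funM => //; exact: mf.
  move=> x /= ax; rewrite -EFinM lee_fin !normal_pdfE ?oner_eq0//.
  rewrite /normal_peak /normal_fun subr0 expr1n mul1r sqr_sqrtr//.
  rewrite -mulrnAr.
  rewrite (sqrtrM (pi *+ 2)) // invfM /K.
  rewrite (_ : _ * _ * (_ * _ * _) = (Num.sqrt 2 / Num.sqrt 2) *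
     ((Num.sqrt (pi *+ 2))^-1 * (expR (- (a ^+ 2 / 4)) * expR (- x ^+ 2 / (2 *+ 2)))));
   last by ring.
  rewrite divff// mul1r ler_wpM2l ?invr_ge0 ?sqrtr_ge0// -expRD ler_expR.
  have : a ^+ 2 <= x ^+ 2 by rewrite -[x ^+ 2]real_normK ?num_real// lerXn2r ?nnegrE// ltW.
  by rewrite -mulr_natr; lra.
apply: le_trans pdf_le _.
rewrite ge0_integralZl//; first last.
- by move=> x _; rewrite lee_fin normal_pdf_ge0.
- exact: mf.
rewrite -[leRHS]mule1 lee_wpmul2l ?lee_fin//.
rewrite -(integral_normal_pdf 0 (Num.sqrt 2)).
apply: ge0_subset_integral => //; first exact: mf.
by move=> x _; rewrite lee_fin normal_pdf_ge0.
Qed.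

Lemma normal_prob_small_ball_lt1 :
  exists2 c : R, 0 < c & (normal_prob 0 1 [set x : R | `|x| <= c]%R <= (2^-1)%:E)%E.
Proof.
pose c := (4 * normal_peak 1)^-1 : R.
have p0 : 0 < normal_peak 1 :> R by apply: normal_peak_gt0; rewrite oner_eq0.
have c0 : 0 < c by rewrite invr_gt0 mulr_gt0.
exists c => //; rewrite /normal_prob.
have -> : [set x : R | `|x| <= c] = `[- c, c]%classic.
  by apply/seteqP; split => x /=; rewrite in_itv/= ler_norml.
have pdf_le : (\int[mu]_(x in `[(- c)%R, c]%classic) (normal_pdf 0 1 x)%:E <=
    \int[mu]_(x in `[(- c)%R, c]%classic) (normal_peak 1)%:E)%E.
  apply: ge0_le_integral => //.
  - by move=> x _; rewrite lee_fin normal_pdf_ge0.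
  - by apply: measurable_funTS; apply/measurable_EFinP; exact: measurable_normal_pdf.
  - by move=> x _; rewrite lee_fin normal_pdf_ub// oner_eq0.
apply: le_trans pdf_le _.
rewrite integral_cst//= lebesgue_measure_itv/= lte_fin.
rewrite (_ : - c < c); last by lra.
rewrite -EFinD -EFinM lee_fin /c; rewrite le_eqVlt; apply/orP; left; apply/eqP.
by field; rewrite gt_eqF.
Qed.

End gaussian.

Section iid_normal.
Context d (T : measurableType d) (R : realType) (P : probability T R).
Variable Z : nat -> {RV P >-> R}.
Hypothesis Z_iid : iid_standard_normal Z.

Lemma iid_preimage_prob (j : nat) (A : set R) : (1 <= j)%N -> measurable A ->
  P (Z j @^-1` A) = normal_prob 0 1 A.
Proof. by move=> j1 mA; have [_ /(_ j j1)] := Z_iid; exact. Qed.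

Lemma measurable_norm_le (c : R) : measurable [set x : R | `|x| <= c].
Proof.
have -> : [set x : R | `|x| <= c] = `[- c, c]%classic.
  by apply/seteqP; split => x /=; rewrite in_itv/= ler_norml.
exact: measurable_itv.
Qed.

Lemma measurable_norm_gt (c : R) : measurable [set x : R | c < `|x|].
Proof.
rewrite (_ : [set x | _] = ~` [set x : R | `|x| <= c]).
  exact: measurableC (measurable_norm_le c).
by apply/seteqP; split => x /= h; [apply/negP; rewrite -ltNge|rewrite ltNge; apply/negP].
Qed.

Lemma measurable_RV_preimage (j : nat) (A : set R) : measurable A -> measurable (Z j @^-1` A).
Proof. by move=> mA; rewrite -[X in measurable X]setTI; apply: measurable_funPT. Qed.

Lemma ae_linear_growth :
  {ae P, forall w, exists n0 : nat, forall j, (n0 <= j)%N -> `|Z j w| <= 2 * (1 + j%:R)}.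
Proof.
pose F (j : nat) := Z j.+1 @^-1` [set x : R | 2 * (1 + j%:R) < `|x|].
have mF j : measurable (F j) by apply: measurable_RV_preimage; exact: measurable_norm_gt.
have PF j : (P (F j) <= (Num.sqrt 2 / (2 ^ (j + 1))%:R)%:E)%E.
  rewrite /F iid_preimage_prob//; last exact: measurable_norm_gt.
  have j0 : 0 <= 2 * (1 + j%:R) :> R by rewrite mulr_ge0// addr_ge0.
  apply: le_trans (normal_prob_tail _ _ j0) _; rewrite lee_fin ler_wpM2l ?sqrtr_ge0//.
  rewrite expRN lef_pV2 ?posrE ?expR_gt0 ?ltr0n ?expn_gt0// natrX.
  apply: (@le_trans _ _ (expR 1 ^+ (j + 1))).
    rewrite lerXn2r ?nnegrE ?expR_ge0//.
    by apply: le_trans _ (expR_ge1Dx 1); rewrite -natr1.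
  rewrite -expRM_natl ler_expR mulr1 natrD.
  have : 0 <= j%:R :> R by [].
  nra.
exists (lim_sup_set F); split.
- apply: bigcap_measurable => // n _.
  by apply: bigcup_measurable => k _; exact: mF.
- apply: lim_sup_set_cvg0 => //.
  apply: (@le_lt_trans _ _ (\sum_(0 <= n <oo) (Num.sqrt 2 / (2 ^ (n + 1))%:R)%:E)%E).
    by apply: lee_nneseries => // n _; exact: PF.
  have := @cvg_geometric_eseries_half R (Num.sqrt 2) 0.
  by move=> /cvg_lim => ->//; rewrite ltry.
- move=> w /= nlin n _; apply: contrapT => nF; apply: nlin.
  exists n.+1 => -[//|j] nj; rewrite leNgt; apply/negP => jF; apply: nF.
  exists j => //=; apply: le_lt_trans jF.
  by rewrite ler_wpM2l// lerD2l ler_nat.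
Qed.

Lemma prode_half_le (f : nat -> \bar R) (s : seq nat) :
  (forall j, j \in s -> (0 <= f j <= (2^-1)%:E)%E) ->
  (0 <= \prod_(j <- s) f j <= ((2^-1) ^+ size s)%:E)%E.
Proof.
elim: s => [|j s IH] fs; first by rewrite big_nil/= expr0 lee_fin ler01 lexx.
have /andP[f0 f1] := fs j (mem_head _ _).
have /andP[p0 p1] : (0 <= \prod_(j <- s) f j <= ((2^-1) ^+ size s)%:E)%E.
  by apply: IH => k ks; apply: fs; rewrite in_cons ks orbT.
rewrite big_cons mule_ge0//= exprS EFinM.
exact: lee_pmul.
Qed.

Lemma ae_not_eventually_small (c : R) :
  (normal_prob 0 1 [set x : R | `|x| <= c]%R <= (2^-1)%:E)%E ->
  {ae P, forall w, forall n0 : nat, exists2 j, (n0 < j)%N & c < `|Z j w|}.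
Proof.
move=> pc; apply: ae_foralln => n0.
pose A : set R := [set x : R | `|x| <= c].
pose B := \bigcap_(j in [set j | (n0 < j)%N]) (Z j @^-1` A).
have mA : measurable A by exact: measurable_norm_le.
exists B; split.
- by apply: bigcap_measurableType => j _; exact: measurable_RV_preimage.
- apply/eqP; rewrite eq_le measure_ge0 andbT.
  apply/lee_addgt0Pr => e e0; rewrite add0e.
  have [N Ne] := @half_pow_small R 1 e e0.
  pose J := seq_fset tt (iota n0.+1 N).
  have JE j : (j \in J) = (n0 < j < n0.+1 + N)%N by rewrite seq_fsetE mem_iota.
  have [indep _] := Z_iid.
  have mBJ : measurable (\bigcap_(j in [set` J]) (Z j @^-1` A)).
    by apply: fin_bigcap_measurable => // j _; exact: measurable_RV_preimage.
  apply: (@le_trans _ _ (P (\bigcap_(j in [set` J]) (Z j @^-1` A)))).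
    apply: le_measure; rewrite ?inE//.
      by apply: bigcap_measurableType => j _; exact: measurable_RV_preimage.
    by move=> w Bw j /=; rewrite JE => /andP[n0j _]; exact: Bw.
  rewrite (indep J (fun=> A))//; last first.
    by move=> j /=; rewrite JE => /andP[n0j _]; exact: leq_trans n0j.
  have half j : j \in (J : seq nat) -> (0 <= P (Z j @^-1` A) <= (2^-1)%:E)%E.
    rewrite JE => /andP[n0j _]; rewrite measure_ge0/=.
    by rewrite iid_preimage_prob//; exact: leq_trans n0j.
  have /andP[_ PJ] := prode_half_le _ _ half.
  apply: le_trans PJ _.
  rewrite lee_fin size_seq_fset undup_id ?iota_uniq// size_iota.
  by move: Ne; rewrite mul1r exprVn.
- move=> w /= nj j /= n0j; rewrite /A /= leNgt; apply/negP => cj; apply: nj.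
  by exists j.
Qed.

End iid_normal.

Section conclusion.
Variable R : realType.

Lemma eventually_linear_growth (z : nat -> R) (n0 : nat) :
  (forall j, (n0 <= j)%N -> `|z j| <= 2 * (1 + j%:R)) ->
  exists2 A : R, 0 <= A & forall j, `|z j| <= A * (1 + j%:R).
Proof.
move=> zn0; pose S := \sum_(i < n0) `|z i|.
have S0 : 0 <= S by exact: sumr_ge0.
exists (2 + S) => [|j]; first by rewrite addr_ge0.
have j0 : 1 <= 1 + j%:R :> R by rewrite lerDl.
have [jn0|/zn0 zj] := ltnP j n0.
  have : `|z j| <= S by rewrite /S (bigD1 (Ordinal jn0))//= lerDl sumr_ge0.
  nra.
apply: le_trans zj _; rewrite ler_wpM2r ?lerDl//; lra.
Qed.

Lemma open_nonneg_gt0 (I : set R) (t0 : R) :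
  open I -> I `<=` [set t : R | 0 <= t] -> I t0 -> 0 < t0.
Proof.
move=> oI I0 It0; have /nbhs_ballP[e /= e0 eI] := oI t0 It0.
have : I (t0 - e / 2).
  by apply: eI; rewrite /ball/= opprB addrC subrK ger0_norm; lra.
by move=> /I0 /=; lra.
Qed.

Lemma decay_eventually_small (b : R) (z : nat -> R) (A mu c : R) :
  2 <= b -> 0 <= A -> 0 < mu -> 0 < c ->
  (forall j, (1 <= j)%N -> `|z j| <= A * b `^ (- (mu * j%:R))) ->
  exists n0 : nat, forall j, (n0 < j)%N -> `|z j| <= c.
Proof.
move=> b2 A0 mu0 c0 zA; have A1 : 0 < A + 1 by lra.
have [m m1 mc] := powRN_small _ _ b2 _ _ mu0 (divr_gt0 c0 A1).
exists m => j mj; apply: le_trans (zA j (leq_trans m1 (ltnW mj))) _.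
apply: (@le_trans _ _ (A * (c / (A + 1)))).
  rewrite ler_wpM2l//; apply: le_trans mc; apply: ler_powR; first lra.
  by rewrite lerN2 ler_wpM2l ?ler_nat ?(ltnW mj)// ltW.
by rewrite mulrCA ler_piMr ?(ltW c0)// ler_pdivrMr// mul1r lerDl.
Qed.

End conclusion.

Theorem theorem4p9 (R : realType) (d : measure_display) (T : measurableType d)
    (P : probability T R) (lambda : R) (Z : nat -> {RV P >-> R})
    (H : R -> R) (I : set R)
    (lambda_ge2 : 2 <= lambda)
    (Z_iid : iid_standard_normal Z)
    (H01 : forall t : R, 0 <= t -> 0 < H t < 1)
    (I_open : open I)
    (I_itv : is_interval I)
    (I_nneg : I `<=` [set t : R | 0 <= t])
    (H_lt_holder : forall t : R, I t -> ((H t)%:E < local_holder_exponent H t)%E) :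
  {ae P, forall w : T, forall t0 : R, I t0 ->
    [set p : R * R | frontier_region p /\
       microlocal_frontier (weierstrass lambda H Z w) t0 p.1 = (p.2)%:E] =
    [set p : R * R | frontier_region p /\ p.2 = H t0 + p.1]}.
Proof.
have [c c0 hc] := normal_prob_small_ball_lt1 R.
apply: filterS2 (ae_linear_growth _ _ _ _ _ Z_iid)
  (ae_not_eventually_small _ _ _ _ _ Z_iid _ hc) => w [n0 zn0] not_small t0 It0.
have [A A0 zA] := eventually_linear_growth _ _ _ zn0.
have t00 : 0 < t0 by exact: open_nonneg_gt0 It0.
have /andP[h0 h1] := H01 t0 (ltW t00).
have [beta [CH [r0 [hbeta CH0 r00 HH]]]] :=
  local_holder_exponent_gt _ _ _ _ t00 h1 (H_lt_holder t0 It0).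
have frontierE s' : s' < 0 ->
    microlocal_frontier (weierstrass lambda H Z w) t0 s' = (H t0 + s')%:E.
  apply: microlocal_frontierE => // [a ah|h' C r hh' C0 r_gt0 holdX].
    exact: (weierstrass_locally_holder _ _ lambda_ge2 _ _ A0 zA _ _ _ _ _ h0 hbeta CH0 r00 HH).
  have [A' [mu [A'0 mu0 zA']]] := weierstrass_pointwise_decay _ _ lambda_ge2 _ _ A0 zA
    _ _ _ _ _ h0 hbeta CH0 r00 HH _ _ _ hh' C0 r_gt0 holdX.
  have [n hn] := decay_eventually_small _ _ _ _ _ _ lambda_ge2 A'0 mu0 c0 zA'.
  have [j nj cj] := not_small n.
  by have := hn j nj; rewrite leNgt cj.
apply/seteqP; split => -[s' sigma] /= [reg]; have [/andP[_ s0] _] := reg.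
  by rewrite frontierE// => -[e]; split.
by move=> e; rewrite frontierE// -e; split.
Qed.
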